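(* Let $(G,\tau)$ be a MAP abelian group, and let $\mathcal{T}$ be a locally quasi-convex group topology on the abelian group $G$. Then $\mathcal{T}$ is compatible with $\tau$ if and only if there is a directed subset $\mathcal{K}$ of $\mathrm{Mac}(G)$ such that $\mathcal{T}=\bigvee_{K\in\mathcal{K}}\mathcal{T}_K$. In this case one can take $\mathcal{K}=\{U^{\triangleright}: U \text{ is a quasi-convex neighborhood of } 0 \text{ in } (G,\mathcal{T})\}$.
   Context: Abelian groups are written additively. $\mathbb{S}$ is the unit circle group and $\mathbb{S}_+=\{z\in\mathbb{S}:\mathrm{Re}(z)\ge 0\}$. For an abelian topological group $G=(G,\tau)$, $\widehat{G}$ is the group of continuous characters (continuous homomorphisms $G\to\mathbb{S}$), $G^\ast$ is the group of all homomorphisms $G\to\mathbb{S}$, and $(\chi,g):=\chi(g)$. $G$ is MAP (maximally almost periodic) if $\widehat{G}$ separates the points of $G$. For $A\subseteq G$: $A^{\triangleright}=\{\chi\in\widehat{G}:\chi(A)\subseteq\mathbb{S}_+\}$ and $A^{\blacktriangleright}=\{\chi\in G^\ast:\chi(A)\subseteq\mathbb{S}_+\}$. For $B\subseteq\widehat{G}$: $B^{\triangleleft}=\{g\in G:(\chi,g)\in\mathbb{S}_+ \text{ for all }\chi\in B\}$. For a subset $A$ of an abelian group, $(1)A:=A$ and $(n+1)A:=(n)A+A$. A subset $A$ of an abelian topological group $G$ is quasi-convex if for every $g\in G\setminus A$ there is $\chi\in\widehat{G}$ with $\chi(A)\subseteq\mathbb{S}_+$ and $\chi(g)\notin\mathbb{S}_+$.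 $G$ (or its topology) is locally quasi-convex if it is Hausdorff and has a neighborhood base at $0$ of quasi-convex sets. $\sigma(\widehat{G},G)$ is the topology of pointwise convergence on $G$; $\widehat{G}_{\sigma^\ast}:=(\widehat{G},\sigma(\widehat{G},G))$, whose continuous characters are exactly the evaluations at elements of $G$ (so $K\subseteq\widehat{G}_{\sigma^\ast}$ is quasi-convex iff $K=K^{\triangleleft\triangleright}$). $\mathrm{Mac}(G)$ is the family of all quasi-convex compact subsets $K$ of $\widehat{G}_{\sigma^\ast}$ such that for every finite $F\subseteq\widehat{G}$ with $0\in F$ and every integer $n\ge1$, the subset $((n)K+F)^{\triangleleft\blacktriangleright}$ of $G^\ast$ is contained in $\widehat{G}$. For a quasi-convex $K\subseteq\widehat{G}_{\sigma^\ast}$, $\mathcal{T}_K$ is the group topology on $G$ having as a base at zero the sets $((n)K+F)^{\triangleleft}$, where $n\ge 1$ and $0\in F\subseteq\widehat{G}$ is finite. Two group topologies $\mu,\nu$ on $G$ are compatible if $\widehat{(G,\mu)}=\widehat{(G,\nu)}$. A family $\mathcal{A}$ of sets is directed if for all $A_1,A_2\in\mathcal{A}$ there is $A\in\mathcal{A}$ with $A_1\cup A_2\subseteq A$. $\bigvee$ denotes the supremum of group topologies, i.e. the coarsest group topology finer than all of them. *)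

(* Defs.v *)
From HB Require Import structures.
From mathcomp Require Import all_boot all_order all_algebra.
From mathcomp Require Import complex lra.
From mathcomp Require Import all_classical all_reals all_analysis.

Set Implicit Arguments.
Unset Strict Implicit.
Unset Printing Implicit Defensive.

Import Order.TTheory GRing.Theory Num.Theory.
Import numFieldNormedType.Exports.

Local Open Scope classical_set_scope.
Local Open Scope ring_scope.
Local Open Scope complex_scope.

(* R[i] only inherits its norm topology through the regular module R[i]^o. *)
HB.instance Definition _ (R : rcfType) := NormedModule.copy R[i] R[i]^o.

Section Sumset.
Variable V : zmodType.

Definition sumset (A B : set V) : set V := [set a + b | a in A & b in B].

(* (n)A = A + ... + A, with n summands; only meant for n >= 1 *)
Definition nfold (A : set V) (n : nat) : set V :=
  iter n.-1 (fun B => sumset B A) A.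

End Sumset.

Section Gstar.
Variables (R : realType) (G : zmodType).

Definition is_character (chi : G -> R[i]) : Prop :=
  (forall x, `|chi x| = 1) /\ (forall x y, chi (x + y) = chi x * chi y).

(* The group G^* of all homomorphisms from G to the unit circle of R[i];    *)
(* its group law, the pointwise product, is written additively.             *)
Record gstar := Gstar {
  gstar_fun :> G -> R[i];
  gstar_funP : `[< is_character gstar_fun >] }.

HB.instance Definition _ := [isSub for gstar_fun].
HB.instance Definition _ := [Choice of gstar by <:].

Lemma gstarP (chi : gstar) : is_character chi.
Proof. exact/asboolP/gstar_funP. Qed.

Lemma gstar_eqP (chi psi : gstar) : chi =1 psi -> chi = psi.
Proof. by move=> e; apply/val_inj/funext. Qed.

Lemma gstar_neq0 (chi : gstar) x : chi x != 0.
Proof. by rewrite -normr_gt0 (proj1 (gstarP chi)). Qed.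

Fact gstar0_subproof : `[< is_character (fun _ => 1) >].
Proof. by apply/asboolP; split=> *; rewrite ?normr1 ?mulr1. Qed.
Definition gstar0 := Gstar gstar0_subproof.

Fact gstarN_subproof (chi : gstar) : `[< is_character (fun x => (chi x)^-1) >].
Proof.
case: (gstarP chi) => n m; apply/asboolP; split=> [x|x y].
  by rewrite normfV n invr1.
by rewrite m invfM.
Qed.
Definition gstarN chi := Gstar (gstarN_subproof chi).

Fact gstarD_subproof (chi psi : gstar) :
  `[< is_character (fun x => chi x * psi x) >].
Proof.
case: (gstarP chi) => n m; case: (gstarP psi) => n' m'; apply/asboolP.
by split=> [x|x y]; rewrite ?normrM ?n ?n' ?mulr1 // m m' mulrACA.
Qed.
Definition gstarD chi psi := Gstar (gstarD_subproof chi psi).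

Fact gstar_addA : associative gstarD.
Proof. by move=> a b c; apply: gstar_eqP => x /=; rewrite mulrA. Qed.
Fact gstar_addC : commutative gstarD.
Proof. by move=> a b; apply: gstar_eqP => x /=; rewrite mulrC. Qed.
Fact gstar_add0 : left_id gstar0 gstarD.
Proof. by move=> a; apply: gstar_eqP => x /=; rewrite mul1r. Qed.
Fact gstar_addN : left_inverse gstar0 gstarN gstarD.
Proof. by move=> a; apply: gstar_eqP => x /=; rewrite mulVf ?gstar_neq0. Qed.

HB.instance Definition _ :=
  GRing.isZmodule.Build gstar gstar_addA gstar_addC gstar_add0 gstar_addN.

End Gstar.

Section Dual.
Variables (R : realType) (X : topologicalZmodType).

Definition continuous_chars : set (gstar R X) :=
  [set chi | continuous (chi : X -> R[i])].

Definition continuous_char : {pred gstar R X} :=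
  fun chi => `[< continuous_chars chi >].

Fact continuous_char_zmod : zmod_closed continuous_char.
Proof.
split=> [|a b /asboolP ca /asboolP cb]; first by apply/asboolP => x; exact: cvg_cst.
apply/asboolP => x; rewrite /continuous_at /=.
by apply: cvgM; [exact: ca|apply: cvgV; [exact: gstar_neq0|exact: cb]].
Qed.

HB.instance Definition _ :=
  GRing.isZmodClosed.Build (gstar R X) continuous_char continuous_char_zmod.

(* The group of continuous characters of X, as a subgroup of gstar R X *)
Record dual := Dual {
  dual_char :> gstar R X;
  dual_charP : dual_char \in continuous_char }.

HB.instance Definition _ := [isSub for dual_char].
HB.instance Definition _ := [Choice of dual by <:].
HB.instance Definition _ := [SubChoice_isSubZmodule of dual by <:].

Definition dual_eval (chi : dual) : {ptws X -> R[i]} := chi : X -> R[i].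

(* dual R X carries sigma(dual, X), the topology of pointwise convergence *)
HB.instance Definition _ :=
  Topological.copy dual (initial_topology dual_eval).

Fact dual_sub_continuous : continuous (fun z : dual * dual => z.1 - z.2).
Proof.
have ev : continuous dual_eval by exact: initial_continuous.
have evx x : continuous (fun chi : dual => chi x : R[i]).
  move=> chi; have FF : Filter (dual_eval @ nbhs chi).
    by refine (@fmap_filter dual _ dual_eval (nbhs chi) _).
  exact: (proj1 (pointwise_cvgP (dual_eval chi) FF) (ev chi) x).
have ec : continuous (fun z : dual * dual => dual_eval (z.1 - z.2)).
  move=> z; apply: (proj2 (pointwise_cvgP _ _)) => x.
  have c1 : (fun y : dual * dual => y.1 x) @ z --> (z.1 x : R[i]).
    by refine (cvg_comp (fun y : dual * dual => y.1) _ cvg_fst (@evx x z.1)).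
  have c2 : (fun y : dual * dual => y.2 x) @ z --> (z.2 x : R[i]).
    by refine (cvg_comp (fun y : dual * dual => y.2) _ cvg_snd (@evx x z.2)).
  exact: (cvgM c1 (cvgV (gstar_neq0 z.2 x) c2)).
move: ec => /continuousP ec; apply/continuousP => A [B Bo <-].
exact: ec.
Qed.

HB.instance Definition _ :=
  PreTopologicalNmodule_isTopologicalZmodule.Build dual dual_sub_continuous.

End Dual.

Arguments continuous_chars R X : clear implicits.

Section Polars.
Variables (R : realType) (X : topologicalZmodType).

Definition Splus : set R[i] := [set z | `|z| = 1 /\ 0 <= complex.Re z].

Definition MAP : Prop :=
  forall x y : X, x <> y -> exists chi : dual R X, chi x <> chi y.

Definition polar (A : set X) : set (dual R X) :=
  [set chi | chi @` A `<=` Splus].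

Definition star_polar (A : set X) : set (gstar R X) :=
  [set chi | chi @` A `<=` Splus].

Definition prepolar (B : set (dual R X)) : set X :=
  [set x | forall chi, B chi -> Splus (chi x)].

Definition quasi_convex (A : set X) : Prop :=
  forall x, ~ A x ->
    exists chi : dual R X, chi @` A `<=` Splus /\ ~ Splus (chi x).

Definition locally_quasi_convex : Prop :=
  hausdorff_space X /\
  forall U, nbhs (0 : X) U ->
    exists V, [/\ nbhs (0 : X) V, quasi_convex V & V `<=` U].

End Polars.

Arguments polar R {X} A.
Arguments star_polar R {X} A.

(* Group topologies on G, given by their open sets, so that several of them *)
(* can be compared on the same group                                        *)
Record group_topology (G : zmodType) := GroupTopology {
  gopen : set_system G;
  gopenT : gopen setT;
  gopenI : setI_closed gopen;
  gopen_bigU : forall (I : Type) (f : I -> set G),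
    (forall i, gopen (f i)) -> gopen (\bigcup_i f i);
  gopenD : forall x y U, gopen U -> U (x + y) ->
    exists V W, [/\ gopen V, gopen W, V x, W y & sumset V W `<=` U];
  gopenN : forall U, gopen U -> gopen (-%R @^-1` U) }.

Definition with_topology (G : zmodType) (t : group_topology G) : Type := G.

Section WithTopology.
Variables (G : zmodType) (t : group_topology G).
Local Notation Gt := (with_topology t).

HB.instance Definition _ := GRing.Zmodule.on Gt.
HB.instance Definition _ :=
  @isOpenTopological.Build Gt (gopen t) (@gopenT _ t) (@gopenI _ t)
    (@gopen_bigU _ t).

Fact with_topology_add_continuous : continuous (fun z : Gt * Gt => z.1 + z.2).
Proof.
move=> [x y] A; rewrite nbhsE => -[U [Uo Uxy] UA].
have [V [W [Vo Wo Vx Wy VWU]]] := @gopenD _ t x y U Uo Uxy.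
exists (V, W) => /=.
  by split; apply: open_nbhs_nbhs.
by move=> [a b] /= [Va Wb]; apply: UA; apply: VWU; exists a => //; exists b.
Qed.

Fact with_topology_opp_continuous : continuous (-%R : Gt -> Gt).
Proof. by apply/continuousP => A; exact: (@gopenN _ t). Qed.

HB.instance Definition _ :=
  PreTopologicalNmodule_isTopologicalNmodule.Build Gt
    with_topology_add_continuous.
HB.instance Definition _ :=
  TopologicalNmodule_isTopologicalZmodule.Build Gt
    with_topology_opp_continuous.

End WithTopology.

(* T is the coarsest group topology finer than all the members of S *)
Definition is_join (G : zmodType) (S : set (group_topology G))
    (T : group_topology G) : Prop :=
  (forall t, S t -> gopen t `<=` gopen T) /\
  (forall T', (forall t, S t -> gopen t `<=` gopen T') ->
    gopen T `<=` gopen T').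

Section Mac.
Variables (R : realType) (X : topologicalZmodType).
Implicit Types K F : set (dual R X).

(* X carries the reference topology tau *)
Definition compatible (T : group_topology X) : Prop :=
  continuous_chars R (with_topology T) = continuous_chars R X
    :> set (gstar R X).

Definition Mac : set (set (dual R X)) :=
  [set K | [/\ quasi_convex R K, compact K &
    forall F n, finite_set F -> F 0 -> (1 <= n)%N ->
      star_polar R (prepolar (sumset (nfold K n) F))
        `<=` continuous_chars R X]].

Definition directed (KK : set (set (dual R X))) : Prop :=
  forall A B, KK A -> KK B -> exists2 C, KK C & A `|` B `<=` C.

Definition TK_base K : set_system X :=
  [set V | exists n F, [/\ (1 <= n)%N, finite_set F, F 0 &
                          V = prepolar (sumset (nfold K n) F)]].

Lemma norm_le_of_sqr (a b : R) : 0 <= a -> 0 <= a * a - b * b ->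
  0 <= a - b /\ 0 <= a + b.
Proof.
move=> a0; rewrite subr_ge0 -!expr2 -real_normK ?num_real //.
rewrite ler_sqr ?nnegrE // ler_norml => /andP[ab ba].
by split; lra.
Qed.

Lemma Splus1 : Splus (1 : R[i]).
Proof. by split; [exact: normr1|rewrite /= ler01]. Qed.

Lemma quasi_convex0 K : quasi_convex R K -> K 0.
Proof.
move=> qK; apply: contrapT => /qK [xi [_ []]].
suff -> : xi 0 = 1 by exact: Splus1.
have [_ m] := gstarP xi; apply: (mulIf (gstar_neq0 xi 0)).
by rewrite mul1r -m addr0.
Qed.

Lemma nfoldS K n : (1 <= n)%N -> nfold K n.+1 = sumset (nfold K n) K.
Proof. by case: n. Qed.

Section TK.
Variables (K : set (dual R X)) (qK : quasi_convex R K).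

Let K0 : K 0. Proof. exact: quasi_convex0. Qed.

Lemma nfold_le m n : (1 <= m)%N -> nfold K m `<=` nfold K (m + n).
Proof.
move=> m1; elim: n => [|n IH]; first by rewrite addn0.
move=> x /IH h; rewrite addnS nfoldS ?addn_gt0 ?m1 //.
by exists x => //; exists 0 => //; rewrite addr0.
Qed.

Lemma nfoldD m n x y : (1 <= m)%N -> (1 <= n)%N ->
  nfold K m x -> nfold K n y -> nfold K (m + n) (x + y).
Proof.
move=> m1; elim: n y => // n IH y _ hx.
case: n IH => [_ hy|n IH]; first by rewrite addn1 nfoldS //; exists x => //; exists y.
rewrite nfoldS // => -[a ha [b hb <-]].
rewrite addnS nfoldS ?addn_gt0 ?m1 // addrA.
by exists (x + a); [exact: IH|exists b].
Qed.

Lemma TK_baseI U V : TK_base K U -> TK_base K V ->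
  exists2 W, TK_base K W & W `<=` U `&` V.
Proof.
move=> [n [F [n1 fF F0 ->]]] [m [E [m1 fE E0 ->]]].
exists (prepolar (sumset (nfold K (n + m)) (F `|` E))).
  exists (n + m)%N, (F `|` E); split=> //; last by left.
    by rewrite addn_gt0 n1.
  by rewrite finite_setU.
move=> x hx; split=> chi [a ha [b hb <-]]; apply: hx.
  by exists a; [exact: nfold_le|exists b => //; left].
by exists a; [rewrite addnC; exact: nfold_le|exists b => //; right].
Qed.

Lemma TK_base_half U : TK_base K U ->
  exists2 W, TK_base K W & sumset W W `<=` U.
Proof.
move=> [n [F [n1 fF F0 ->]]].
exists (prepolar (sumset (nfold K (n + n)) (sumset F F))).
  exists (n + n)%N, (sumset F F); split=> //.
  - by rewrite addn_gt0 n1.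
  - exact: finite_image2.
  - by exists 0 => //; exists 0 => //; rewrite addr0.
move=> _ [x hx [y hy <-]] chi hchi.
have h1 z : prepolar (sumset (nfold K (n + n)) (sumset F F)) z ->
    0 <= complex.Re (chi z) /\ 0 <= complex.Re (chi z * chi z).
  case: hchi => a ha [b hb <-] hz; split.
    apply: (proj2 (hz (a + b) _)); exists a; first exact: nfold_le.
    by exists b => //; exists b => //; exists 0 => //; rewrite addr0.
  apply: (proj2 (hz (a + b + (a + b)) _)); exists (a + a); first exact: nfoldD.
  by exists (b + b); [exists b => //; exists b|rewrite addrACA].
have [n' m'] := gstarP chi; split; first exact: n'.
rewrite m'; have [] := h1 x hx; have [] := h1 y hy.
case: (chi x) => a b; case: (chi y) => c d /=.
move=> c0 /(norm_le_of_sqr c0) [cd cd'] a0 /(norm_le_of_sqr a0) [ab ab'].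
have := mulr_ge0 ab cd'; have := mulr_ge0 ab' cd; lra.
Qed.

Lemma TK_base0 U : TK_base K U -> U 0.
Proof.
move=> [n [F [n1 fF F0 ->]]] chi _.
suff -> : chi 0 = 1 by exact: Splus1.
have [_ m] := gstarP chi; apply: (mulIf (gstar_neq0 chi 0)).
by rewrite mul1r -m addr0.
Qed.

Lemma TK_baseN U x : TK_base K U -> U x -> U (- x).
Proof.
move=> [n [F [n1 fF F0 ->]]] hx chi /hx [nx rx].
have [nn m] := gstarP chi; split; first exact: nn.
have c0 : chi 0 = 1.
  by apply: (mulIf (gstar_neq0 chi 0)); rewrite mul1r -m addr0.
have -> : chi (- x) = (chi x)^-1.
  apply: (mulIf (gstar_neq0 chi x)).
  by rewrite -m addNr c0 mulVf ?gstar_neq0.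
move: rx; case: (chi x) => a b /= a0.
by rewrite divr_ge0 // addr_ge0 // sqr_ge0.
Qed.

Lemma TK_baseT : exists V, TK_base K V.
Proof.
by eexists; exists 1%N, [set 0]; split=> //; exact: finite_set1.
Qed.

Definition TK_open : set_system X :=
  [set U | forall x, U x -> exists2 V, TK_base K V & forall v, V v -> U (x + v)].

Fact TK_openT : TK_open setT.
Proof. by move=> x _; have [V hV] := TK_baseT; exists V. Qed.

Fact TK_openI : setI_closed TK_open.
Proof.
move=> A B oA oB x [/oA [V hV VA] /oB [W hW WB]].
have [Z hZ ZVW] := TK_baseI hV hW; exists Z => // v /ZVW [Vv Wv].
by split; [exact: VA|exact: WB].
Qed.

Fact TK_open_bigU (I : Type) (f : I -> set X) :
  (forall i, TK_open (f i)) -> TK_open (\bigcup_i f i).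
Proof.
move=> of_ x [i _ /of_ [V hV Vf]]; exists V => // v /Vf.
by exists i.
Qed.

Let TK_int (S : set X) : set X :=
  [set x | exists2 V, TK_base K V & forall v, V v -> S (x + v)].

Let TK_int_open S : TK_open (TK_int S).
Proof.
move=> x [V hV VS]; have [W hW WV] := TK_base_half hV.
exists W => // w Ww; exists W => // v Wv.
by rewrite -addrA; apply/VS/WV; exists w => //; exists v.
Qed.

Let TK_int_sub S : TK_int S `<=` S.
Proof. by move=> x [V /TK_base0 V0 VS]; rewrite -[x]addr0; exact: VS. Qed.

Fact TK_openD x y U : TK_open U -> U (x + y) ->
  exists V W, [/\ TK_open V, TK_open W, V x, W y & sumset V W `<=` U].
Proof.
move=> oU /oU [V hV VU]; have [W hW WV] := TK_base_half hV.
exists (TK_int [set z | W (z - x)]), (TK_int [set z | W (z - y)]); split.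
- exact: TK_int_open.
- exact: TK_int_open.
- by exists W => // w Ww /=; rewrite addrC addKr.
- by exists W => // w Ww /=; rewrite addrC addKr.
move=> _ [a /TK_int_sub /= ha [b /TK_int_sub /= hb <-]].
rewrite -(subrKC (x + y) (a + b)); apply/VU/WV; exists (a - x) => //.
by exists (b - y) => //; rewrite addrACA -opprD.
Qed.

Fact TK_openN U : TK_open U -> TK_open (-%R @^-1` U).
Proof.
move=> oU x /oU [V hV VU]; exists V => // v Vv /=.
by rewrite opprD; apply/VU/(TK_baseN hV).
Qed.

Definition TK : group_topology X :=
  GroupTopology TK_openT TK_openI TK_open_bigU TK_openD TK_openN.

Lemma nbhs_TK (U : set X) :
  nbhs (0 : with_topology TK) U <-> exists2 V, TK_base K V & V `<=` U.
Proof.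
rewrite nbhsE; split=> [[A [Ao A0] AU]|[V hV VU]].
  have [V hV VA] := Ao _ A0; exists V => // v Vv; apply: AU.
  by rewrite -[v]add0r; exact: VA.
exists (TK_int U); last exact: TK_int_sub.
split; first exact: TK_int_open.
by exists V => // v /VU; rewrite add0r.
Qed.

End TK.

(* The topologies TK K for K in KK. The proof of quasi-convexity is only    *)
(* needed for TK to be a group topology.                                    *)
Definition TK_family (KK : set (set (dual R X))) : set (group_topology X) :=
  [set t | exists K (qK : quasi_convex R K), KK K /\ t = TK qK].

Definition generated_by (T : group_topology X) (KK : set (set (dual R X))) :
    Prop :=
  [/\ KK `<=` Mac, directed KK & is_join (TK_family KK) T].

Definition qc_nbhs_polars (T : group_topology X) : set (set (dual R X)) :=
  [set polar R U | U in [set U : set X |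
     nbhs (0 : with_topology T) U /\
     @quasi_convex R (with_topology T) U]].

End Mac.

Arguments qc_nbhs_polars R {X} T.

(* Main.v *)
Require Import Defs.
From mathcomp Require Import all_boot all_order all_algebra.
From mathcomp Require Import complex lra.
From mathcomp Require Import all_classical all_reals all_analysis.
Set Implicit Arguments.
Unset Strict Implicit.
Unset Printing Implicit Defensive.
Import Order.TTheory GRing.Theory Num.Theory.
Import numFieldNormedType.Exports.
Local Open Scope classical_set_scope.
Local Open Scope ring_scope.
Local Open Scope complex_scope.

(** Characters are controlled through the deviation 1 - Re z of a unit complex
number z from 1.  If z has nonnegative real part, then squaring z
multiplies the deviation by at least 2 ([subr1Re_sqr]); and the deviation of a
product is at most twice the sum of the deviations ([subr1Re_mul]).

The first estimate gives the key fact [near_star_polar]: if U is a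
neighborhood of 0, then the homomorphisms that map U into the right half
circle are equicontinuous at 0.  In particular all of them are continuous
([star_polar_nbhs_continuous]).

Suppose that T is compatible with the original topology, let U be a
T-neighborhood of 0, and let K be its polar.  Every homomorphism mapping U into
the half circle is T-continuous, hence belongs to the dual group.  So K is the
full set of such homomorphisms, and it is compact by the Banach-Alaoglu
argument ([compact_polar]); it is quasi-convex because evaluations at points
are continuous.  As (n)K + F is T-equicontinuous for every finite F, by the
second estimate, its prepolar is a T-neighborhood of 0
([prepolar_nfold_polar_nbhs]).  This shows both that K is in Mac and that T is
finer than the topology TK of K.  Conversely a quasi-convex V is the prepolar
of its own polar, so V is a neighborhood of 0 for the topology TK of the polar
of V: the supremum of these topologies is T ([qc_nbhs_polars_join]).

Suppose now that T is the supremum of the TK for K in a directed subfamily KK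
of Mac.  If KK is nonempty, the topologies TK form a directed family, so each
T-neighborhood of 0 is already a TK-neighborhood for some K in KK
([nbhs0_directed_join]).  For a T-continuous character chi this yields K, n
and F such that chi lies in the bipolar of (n)K + F inside G^*, which consists
of continuous characters by the definition of Mac.  Conversely a continuous
character chi maps the prepolar of K + {0, chi} into the half circle, so it is
T-continuous.  If KK is empty, T is indiscrete and Hausdorff, so the group is
trivial. *)

(** * The unit circle *)

Section Circle.
Variable R : realType.
Implicit Types z w : R[i].

Lemma norm1P z : `|z| = 1 <-> complex.Re z ^+ 2 + complex.Im z ^+ 2 = 1.
Proof.
split=> [z1|h]; last first.
  by apply/eqP; rewrite -(@pexpr_eq1 _ _ 2)// -add_Re2_Im2 h.
by apply: (@complexI R); rewrite add_Re2_Im2 z1 expr1n.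
Qed.

Lemma subr1Re_sqr z : `|z| = 1 -> 0 <= complex.Re z ->
  2 * (1 - complex.Re z) <= 1 - complex.Re (z * z).
Proof. by move=> /norm1P; case: z => a b /=; nra. Qed.

Lemma subr1Re_mul z w : `|z| = 1 -> `|w| = 1 ->
  1 - complex.Re (z * w) <= 2 * (1 - complex.Re z) + 2 * (1 - complex.Re w).
Proof.
move=> /norm1P + /norm1P; case: z w => [a b] [c d] /= h k.
(* the difference of the two sides is half the sum of these two squares *)
have := sqr_ge0 (a + c - 2); have := sqr_ge0 (b - d); nra.
Qed.

(** The distance of two unit complex numbers is determined by the deviation of
the real part of their quotient from 1. *)
Lemma norm_subr_sqr z w : `|z| = 1 -> `|w| = 1 ->
  `|z - w| ^+ 2 = (2 * (1 - complex.Re (z / w)))%:C.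
Proof.
move=> /norm1P + /norm1P; case: z w => [a b] [c d] /= h k.
rewrite -add_Re2_Im2 /=; congr (_ %:C); rewrite k !divr1; nra.
Qed.

(** The norm of [R[i]] takes its values in [R[i]] itself; convergence can be
tested with real radii only. *)
Lemma cvg_complexP (T : Type) (F : set_system T) (f : T -> R[i]) z :
  Filter F ->
  f @ F --> z <-> forall e : R, 0 < e -> \forall t \near F, `|z - f t| < e%:C.
Proof.
move=> FF; split=> [/cvgrPdist_lt fz e e0|fz].
  by apply: fz; rewrite ltcR.
apply/cvgrPdist_lt => e; case: e => a b; rewrite ltcE /= => /andP[/eqP -> a0].
exact: fz.
Qed.

Lemma continuous_Re : continuous (@complex.Re R : R[i] -> R).
Proof.
move=> z; apply/(@cvgrPdist_lt _ _ _ _ (nbhs_filter z)) => e e0.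
have e0' : 0 < e%:C by rewrite ltcR.
have : nbhs z (ball z e%:C) by exact: nbhsx_ballx.
apply: filterS => w; rewrite /ball /= -ltcR; apply: le_lt_trans.
by rewrite -raddfB /=; exact: (normc_ge_Re (z - w)).
Qed.

Lemma continuous_Im : continuous (@complex.Im R : R[i] -> R).
Proof.
have -> : @complex.Im R = (fun z => - complex.Re (z * 'i%C)).
  by apply/funext => z; rewrite ReiNIm opprK.
move=> z; apply: (@cvgN _ _ _ _ (nbhs_filter z)).
refine (cvg_comp (fun w : R[i] => w * 'i%C) _ _ (@continuous_Re (z * 'i%C))).
by apply: (@cvgM _ _ _ (nbhs_filter z)); [exact: cvg_id|exact: cvg_cst].
Qed.

Lemma continuous_Complex : continuous (fun p : R * R => p.1 +i* p.2).
Proof.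
move=> [a b]; apply/cvg_complexP => e e0; have e2 : 0 < e / 2 by lra.
exists (ball a (e / 2), ball b (e / 2)); first by split; exact: nbhsx_ballx.
move=> [c d] [/= ac bd]; rewrite normc_def /= ltcR.
rewrite -(gtr0_norm e0) -sqrtr_sqr ltr_sqrt ?exprn_gt0//.
move: ac bd; rewrite /ball /= !ltr_norml => /andP[? ?] /andP[? ?]; nra.
Qed.

Lemma closed_circle : closed [set z : R[i] | `|z| = 1].
Proof.
have -> : [set z : R[i] | `|z| = 1] =
    (fun z => complex.Re z ^+ 2 + complex.Im z ^+ 2) @^-1` [set 1].
  by apply/seteqP; split=> z /norm1P.
apply: closed_comp; last exact: closed_eq.
move=> z _; apply: (@cvgD _ _ _ _ (nbhs_filter z)); rewrite expr2.
  by apply: (@cvgM _ _ _ (nbhs_filter z)); exact: continuous_Re.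
by apply: (@cvgM _ _ _ (nbhs_filter z)); exact: continuous_Im.
Qed.

Lemma compact_circle : compact [set z : R[i] | `|z| = 1].
Proof.
apply: (subclosed_compact closed_circle
  (continuous_compact (continuous_subspaceT continuous_Complex)
    (compact_setX (@segment_compact R (-1) 1) (@segment_compact R (-1) 1)))).
move=> [a b] /norm1P /= h; exists (a, b) => //=; split => /=.
  by rewrite in_itv /=; nra.
by rewrite in_itv /=; nra.
Qed.

Lemma closed_Splus : closed (@Splus R).
Proof.
apply: closedI; first exact: closed_circle.
apply: (@closed_comp _ _ (@complex.Re R) [set x | 0 <= x]); last exact: closed_ge.
by move=> z _; exact: continuous_Re.
Qed.

End Circle.

(** * Continuity of characters *)

Section Characters.
Variables (R : realType) (G : zmodType).
Implicit Types chi : gstar R G.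

Lemma gstar_norm chi x : `|chi x| = 1. Proof. by have [] := gstarP chi. Qed.

Lemma gstar_morphD chi x y : chi (x + y) = chi x * chi y.
Proof. by have [] := gstarP chi. Qed.

Lemma gstar_at0 chi : chi 0 = 1.
Proof.
by apply: (mulIf (gstar_neq0 chi 0)); rewrite mul1r -gstar_morphD addr0.
Qed.

Lemma gstar_morphB chi x y : chi (x - y) = chi x / chi y.
Proof.
by apply: (mulIf (gstar_neq0 chi y)); rewrite -gstar_morphD subrK divfK ?gstar_neq0.
Qed.

End Characters.

Section Continuity.
Variables (R : realType) (X : topologicalZmodType).
Implicit Types chi : gstar R X.

Lemma near_subr (x : X) (U : set X) :
  nbhs (0 : X) U -> \forall y \near x, U (y - x).
Proof.
rewrite -(subrr x) => U0.
have /(_ U U0) // : (fun y => y - x) @ x --> x - x.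
refine (cvg_comp (fun y => (y, x)) _ _ (@sub_continuous X (x, x))).
by apply: cvg_pair; [exact: cvg_id|exact: cvg_cst].
Qed.

Lemma near_addl (x : X) (U : set X) :
  nbhs x U -> \forall v \near (0 : X), U (x + v).
Proof.
rewrite -{1}(addr0 x) => Ux.
have /(_ U Ux) // : (fun v => x + v) @ (0 : X) --> x + 0.
refine (cvg_comp (fun v => (x, v)) _ _ (@add_continuous X (x, 0))).
by apply: cvg_pair; [exact: cvg_cst|exact: cvg_id].
Qed.

Lemma near_double (U : set X) : nbhs (0 : X) U -> \forall y \near (0 : X), U (y + y).
Proof.
rewrite -{1}(addr0 (0 : X)) => U0.
have /(_ U U0) // : (fun y : X => y + y) @ (0 : X) --> (0 : X) + 0.
refine (cvg_comp (fun y => (y, y)) _ _ (@add_continuous X (0, 0))).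
by apply: cvg_pair; exact: cvg_id.
Qed.

(** A character is continuous if and only if its real part tends to 1 at 0. *)
Lemma continuous_charE chi : continuous_chars R X chi <->
  forall e : R, 0 < e -> \forall x \near (0 : X), 1 - complex.Re (chi x) < e.
Proof.
split=> [cchi e e0|H x].
  have c : (fun x => complex.Re (chi x)) @ (0 : X) --> complex.Re (chi 0).
    exact: (cvg_comp _ _ (cchi 0) (@continuous_Re R (chi 0))).
  move/cvgrPdist_lt: c => /(_ e e0); apply: filterS => x.
  by rewrite gstar_at0 /=; apply: le_lt_trans; exact: ler_norm.
apply/(@cvg_complexP R X _ chi (chi x) (nbhs_filter x)) => e e0.
have /near_subr : nbhs (0 : X) [set y | 1 - complex.Re (chi y) < e ^+ 2 / 2].
  by apply: H; rewrite divr_gt0 ?exprn_gt0.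
move=> /(_ x); apply: filterS => y /=; rewrite gstar_morphB => h.
rewrite distrC -(@ltr_pXn2r _ 2)// ?nnegrE ?normr_ge0 ?ler0c ?ltW//.
by rewrite norm_subr_sqr ?gstar_norm// -rmorphXn ltcR; lra.
Qed.

Lemma trivial_char_continuous chi :
  (forall x, chi x = 1) -> continuous_chars R X chi.
Proof.
move=> chi1; apply/continuous_charE => e e0.
by apply: filterE => x; rewrite chi1 /= subrr.
Qed.

(** By induction on n: if x + x is in the n-th neighborhood and x is in U, then
[subr1Re_sqr] halves the bound. *)
Lemma near_star_polar_pow (U : set X) n : nbhs (0 : X) U ->
  \forall x \near (0 : X), forall chi, star_polar R U chi ->
    1 - complex.Re (chi x) <= 2^-1 ^+ n.
Proof.
move=> U0; elim: n => [|n IH].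
  apply: filterS U0 => x Ux chi /(_ (chi x)) [|_ r]; first by exists x.
  by rewrite expr0; lra.
near=> x => chi hchi.
have [_ r] : Splus (chi x) by apply: hchi; exists x => //; near: x.
have := subr1Re_sqr (gstar_norm chi x) r.
have : 1 - complex.Re (chi (x + x)) <= 2^-1 ^+ n.
  by move: chi hchi {r}; near: x; exact: (near_double IH).
by rewrite gstar_morphD exprS; lra.
Unshelve. all: by end_near. Qed.

(** The homomorphisms that map a given neighborhood of 0 into the right half
circle are equicontinuous at 0. *)
Lemma near_star_polar (U : set X) (e : R) : nbhs (0 : X) U -> 0 < e ->
  \forall x \near (0 : X), forall chi, star_polar R U chi ->
    1 - complex.Re (chi x) < e.
Proof.
move=> U0 e0; have := near_star_polar_pow (Num.Def.archi_bound e^-1) U0.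
apply: filterS => x + chi hchi => /(_ chi hchi) /le_lt_trans; apply.
rewrite exprVn invf_plt ?posrE ?exprn_gt0//.
exact: upper_nthrootP.
Qed.

(** For a neighborhood U of 0, continuity is automatic for the homomorphisms in
the polar of U in G^*. *)
Lemma star_polar_nbhs_continuous (U : set X) : nbhs (0 : X) U ->
  star_polar R U `<=` continuous_chars R X.
Proof.
move=> U0 chi hchi; apply/continuous_charE => e e0.
by apply: filterS (near_star_polar U0 e0) => x; exact.
Qed.

End Continuity.

(** * Polars in the dual group *)

Section DualCompact.
Variables (R : realType) (X : topologicalZmodType).

(** Pointwise convergence is convergence in the dual group. *)
Lemma dual_cvg (F : set_system (dual R X)) (FF : Filter F) (chi : dual R X) :
  (forall x, (fun psi : dual R X => psi x : R[i]) @ F --> (chi x : R[i])) ->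
  F --> chi.
Proof.
move=> h A; rewrite /= => -[_ [[B Bo <-] Bchi] BA].
have c : (fun psi : dual R X => dual_eval psi) @ F --> dual_eval chi.
  have FE : Filter (@dual_eval R X @ F) by refine (@fmap_filter _ _ _ F FF).
  exact: (proj2 (pointwise_cvgP (dual_eval chi) FE) h).
have : nbhs (dual_eval chi) B by exact: open_nbhs_nbhs.
by move=> /c FB; exact: (@filterS _ _ FF _ _ BA FB).
Qed.

Lemma dual_eval_at_continuous (x : X) :
  continuous (fun chi : dual R X => chi x : R[i]).
Proof.
have ev : continuous (@dual_eval R X) by exact: initial_continuous.
move=> chi; have FF : Filter (@dual_eval R X @ nbhs chi).
  by refine (@fmap_filter (dual R X) _ (@dual_eval R X) (nbhs chi) _).
exact: (proj1 (pointwise_cvgP (dual_eval chi) FF) (ev chi) x).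
Qed.

(** The separating characters of the dual group are evaluations at points of A. *)
Lemma quasi_convex_polar (A : set X) : quasi_convex R (polar R A).
Proof.
move=> chi nAchi.
have [x Ax nx] : exists2 x, A x & ~ Splus (chi x).
  apply: contrapT => h; apply: nAchi => _ [x Ax <-].
  by apply: contrapT => nx; apply: h; exists x.
have evP : `[< is_character (fun psi : dual R X => psi x) >].
  by apply/asboolP; split=> // psi; exact: gstar_norm.
have evC : Gstar evP \in @continuous_char R (dual R X).
  by apply/asboolP; exact: dual_eval_at_continuous.
exists (Dual evC); split=> //= _ [psi Apsi <-].
by apply: Apsi; exists x.
Qed.

Lemma ultra_cvg_compact (S : Type) (T : topologicalType) (F : set_system S)
    (f : S -> T) (A : set T) :
  UltraFilter F -> compact A -> F (f @^-1` A) -> exists2 p, A p & f @ F --> p.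
Proof.
move=> FU cA FA.
have [p [Ap clp]] := cA (f @ F) _ FA.
exists p => // B Bp; have [//|FnB] := in_ultra_setVsetC (f @^-1` B) FU.
by have [y []] := clp (~` B) B FnB Bp.
Qed.

(** Banach-Alaoglu: along an ultrafilter on the polar, the values at each point
converge in the circle, and the pointwise limit is again a homomorphism that
maps A into the half circle; the hypothesis says that it is continuous. *)
Lemma compact_polar (A : set X) :
  star_polar R A `<=` continuous_chars R X -> compact (polar R A).
Proof.
move=> Acont; rewrite compact_ultra => F FU FA.
have lim x : exists2 p : R[i], `|p| = 1 &
    (fun psi : dual R X => psi x : R[i]) @ F --> p.
  apply: (ultra_cvg_compact FU (@compact_circle R)).
  by apply: filterS FA => psi _ /=; exact: gstar_norm.
pose f x := projT1 (cid2 (lim x)).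
have fn x : `|f x| = 1 by rewrite /f; case: cid2.
have fc x : (fun psi : dual R X => psi x : R[i]) @ F --> f x.
  by rewrite /f; case: cid2.
(* the limit is multiplicative because limits in R[i] are unique *)
have fP : `[< is_character f >].
  apply/asboolP; split=> // x y.
  have c : (fun psi : dual R X => psi (x + y) : R[i]) @ F --> f x * f y.
    rewrite [X in X @ _](_ : _ = (fun psi : dual R X => psi x * psi y)).
      exact: cvgM.
    by apply/funext => psi; rewrite gstar_morphD.
  exact: (cvg_unique (@norm_hausdorff R[i] R[i]) (fc (x + y)) c).
have fA : star_polar R A (Gstar fP).
  move=> _ [x Ax <-] /=; apply: (closed_cvg _ (@closed_Splus R) _ _ (fc x)).
  by apply: filterS FA => psi; apply; exists x.
have fD : Gstar fP \in @continuous_char R X by apply/asboolP; exact: Acont.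
by exists (Dual fD); split=> //; apply: dual_cvg.
Qed.

End DualCompact.

(** * Comparison and directed suprema of group topologies *)

Section GroupTopologies.
Variable G : zmodType.
Implicit Types (s t : group_topology G) (S : set (group_topology G)).

(** Group topologies can be compared at 0. *)
Lemma gopen_subP s t : gopen s `<=` gopen t <->
  (forall U : set G, nbhs (0 : with_topology s) U -> nbhs (0 : with_topology t) U).
Proof.
split=> [st U|st U sU].
  rewrite nbhsE => -[V [Vo V0] VU]; rewrite nbhsE.
  by exists V => //; split=> //; exact: st.
suff : open (U : set (with_topology t)) by [].
rewrite openE => x Ux.
have := @near_addl (with_topology s) x U
  (@open_nbhs_nbhs (with_topology s) x U (conj sU Ux)).
move=> /st /(@near_subr (with_topology t) x); apply: filterS => y /=.
by rewrite subrKC.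
Qed.

(** The sets that are, around each of their points, neighborhoods for some member
of S. They are the open sets of a group topology as soon as S is nonempty and
directed; the axioms for addition and opposite then hold because each of them
involves a single member of S. *)
Definition union_open S : set_system G :=
  [set U | forall x, U x -> exists t V, [/\ S t, gopen t V, V x & V `<=` U]].

Section DirectedUnion.
Variables (S : set (group_topology G)) (t0 : group_topology G).
Hypothesis St0 : S t0.
Hypothesis dirS : forall s t, S s -> S t ->
  exists u, [/\ S u, gopen s `<=` gopen u & gopen t `<=` gopen u].

Fact union_openT : union_open S setT.
Proof. by move=> x _; exists t0, setT; split=> //; exact: gopenT. Qed.

Fact union_openI : setI_closed (union_open S).
Proof.
move=> A B oA oB x [/oA [s [V [Ss Vo Vx VA]]] /oB [t [W [St Wo Wx WB]]]].
have [u [Su su tu]] := dirS Ss St.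
exists u, (V `&` W); split=> //.
  exact: (gopenI (su _ Vo) (tu _ Wo)).
by move=> y [/VA ? /WB].
Qed.

Fact union_open_bigU (I : Type) (f : I -> set G) :
  (forall i, union_open S (f i)) -> union_open S (\bigcup_i f i).
Proof.
move=> of_ x [i _ /of_ [t [V [St Vo Vx Vf]]]].
by exists t, V; split=> // y /Vf; exists i.
Qed.

Fact union_openD x y U : union_open S U -> U (x + y) ->
  exists V W, [/\ union_open S V, union_open S W, V x, W y & sumset V W `<=` U].
Proof.
move=> oU /oU [t [A [St Ao Axy AU]]].
have [V [W [Vo Wo Vx Wy VWA]]] := gopenD Ao Axy.
exists V, W; split=> //; last by move=> z /VWA /AU.
- by move=> z Vz; exists t, V; split.
- by move=> z Wz; exists t, W; split.
Qed.

Fact union_openN U : union_open S U -> union_open S (-%R @^-1` U).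
Proof.
move=> oU x /oU [t [V [St Vo Vx VU]]].
by exists t, (-%R @^-1` V); split=> //; [exact: gopenN|move=> y /VU].
Qed.

(** The supremum of a nonempty directed family of group topologies. *)
Definition directed_union : group_topology G :=
  GroupTopology union_openT union_openI union_open_bigU union_openD union_openN.

(** A neighborhood of 0 for the supremum of a nonempty directed family is already
one for some member of the family. *)
Lemma nbhs0_directed_join T U : is_join S T -> nbhs (0 : with_topology T) U ->
  exists2 t, S t & nbhs (0 : with_topology t) U.
Proof.
move=> [_ least]; rewrite nbhsE => -[V [Vo V0] VU].
have oV : union_open S V.
  apply: (least directed_union) Vo => t St W Wo x Wx; by exists t, W; split.
have [t [W [St Wo W0 WV]]] := oV _ V0; exists t => //.
by rewrite nbhsE; exists W => //; exact: subset_trans VU.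
Qed.

End DirectedUnion.

Section Indiscrete.

(* A set with this property is empty or the whole group. *)
Let iopen : set_system G := [set U | forall x y, U x -> U y].

Fact indiscreteI : setI_closed iopen.
Proof. by move=> A B oA oB x y [/(oA x y) ? /(oB x y)]. Qed.

Fact indiscrete_bigU (I : Type) (f : I -> set G) :
  (forall i, iopen (f i)) -> iopen (\bigcup_i f i).
Proof. by move=> of_ x y [i _ /of_ h]; exists i. Qed.

Fact indiscreteD x y U : iopen U -> U (x + y) ->
  exists V W, [/\ iopen V, iopen W, V x, W y & sumset V W `<=` U].
Proof. by move=> oU /oU h; exists setT, setT; split. Qed.

Fact indiscreteN U : iopen U -> iopen (-%R @^-1` U).
Proof. by move=> oU x y /oU h; exact: h. Qed.

(** The indiscrete group topology. *)
Definition indiscrete : group_topology G :=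
  @GroupTopology _ iopen (fun _ _ _ => I) indiscreteI indiscrete_bigU
    indiscreteD indiscreteN.

(** The supremum of an empty family of group topologies satisfies the first
hypothesis. *)
Lemma hausdorff_indiscrete_trivial T :
  gopen T `<=` gopen indiscrete -> hausdorff_space (with_topology T) ->
  forall x y : G, x = y.
Proof.
move=> Ti hT x y; apply: hT => A B.
rewrite nbhsE => -[U [Uo Ux] UA] /nbhs_singleton By.
by exists y; split=> //; apply: UA; exact: (Ti U Uo x y).
Qed.

End Indiscrete.
End GroupTopologies.

Section Polars.
Variables (R : realType) (X : topologicalZmodType).
Implicit Types (T : group_topology X) (K L F : set (dual R X)).

(** Equicontinuity at 0, for the topology T, of a set K of characters that are
continuous for the original topology of X. It is expressed by the deviation of
the real part from 1, which controls the distance to 1 on the unit circle. *)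
Definition equicontinuous0 T K : Prop :=
  forall e : R, 0 < e -> \forall x \near (0 : with_topology T),
    forall chi, K chi -> 1 - complex.Re (chi x) < e.

Lemma equicontinuous_sumset T K L :
  equicontinuous0 T K -> equicontinuous0 T L -> equicontinuous0 T (sumset K L).
Proof.
move=> eK eL e e0; have e4 : 0 < e / 4 by lra.
apply: filterS2 (eK _ e4) (eL _ e4) => x hK hL _ [a Ka [b Lb <-]].
have := subr1Re_mul (gstar_norm a x) (gstar_norm b x).
have := hK a Ka; have := hL b Lb; rewrite /=; lra.
Qed.

Lemma equicontinuous_nfold T K n :
  equicontinuous0 T K -> equicontinuous0 T (nfold K n).
Proof.
move=> eK; rewrite /nfold; elim: n.-1 => //= m IH.
exact: equicontinuous_sumset.
Qed.

Lemma equicontinuous_finite T F : finite_set F ->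
  (forall chi, F chi -> continuous_chars R (with_topology T) chi) ->
  equicontinuous0 T F.
Proof.
move=> /finite_seqP [s ->] + e e0; elim: s => [|a s IH] cF.
  by apply: filterS filterT => x _ chi; rewrite /= in_nil.
have ha := proj1 (@continuous_charE R (with_topology T) a) (cF a (mem_head _ _)) e e0.
have hs : \forall x \near (0 : with_topology T), forall chi, chi \in s ->
    1 - complex.Re (chi x) < e.
  by apply: IH => chi chis; apply: cF; rewrite /= in_cons chis orbT.
apply: filterS2 ha hs => x hx hs chi /=; rewrite in_cons => /orP[/eqP -> //|].
exact: hs.
Qed.

Lemma prepolar_equicontinuous T K : equicontinuous0 T K ->
  nbhs (0 : with_topology T) (prepolar K).
Proof.
move=> eK; apply: filterS (eK 1 ltr01) => x hx chi /hx h.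
by split; [exact: gstar_norm|lra].
Qed.

Lemma nfold_subset K L n : K `<=` L -> nfold K n `<=` nfold L n.
Proof.
move=> KL; rewrite /nfold; elim: n.-1 => //= m IH _ [a Ka [b Kb <-]].
by exists a; [exact: IH|exists b => //; exact: KL].
Qed.

Lemma TK_subset K L (qK : quasi_convex R K) (qL : quasi_convex R L) :
  K `<=` L -> gopen (TK qK) `<=` gopen (TK qL).
Proof.
move=> KL; apply/gopen_subP => U; rewrite !nbhs_TK => -[_ [n [F [n1 fF F0 ->]]] VU].
exists (prepolar (sumset (nfold L n) F)); first by exists n, F.
apply: subset_trans VU => x hx _ [a Ka [b Fb <-]]; apply: hx.
by exists a; [exact: nfold_subset Ka|exists b].
Qed.

End Polars.

(** * Compatible topologies *)

Section QuasiConvex.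
Variables (R : realType) (X : topologicalZmodType).
Implicit Types U V : set X.

Lemma quasi_convexI U V : quasi_convex R U -> quasi_convex R V ->
  quasi_convex R (U `&` V).
Proof.
move=> qU qV x nUV; have [Ux|/qU [chi [hU nx]]] := pselect (U x).
  have [chi [hV nx]] : exists chi : dual R X, chi @` V `<=` @Splus R /\ ~ Splus (chi x).
    by apply: qV => Vx; apply: nUV.
  by exists chi; split=> // _ [y [_ Vy] <-]; apply: hV; exists y.
by exists chi; split=> // _ [y [Uy _] <-]; apply: hU; exists y.
Qed.

End QuasiConvex.

Section Compatible.
Variables (R : realType) (X : topologicalZmodType) (T : group_topology X).
Implicit Types (A U : set X) (K F : set (dual R X)).

Lemma dual_continuous (chi : dual R X) : continuous_chars R X chi.
Proof. exact/asboolP/dual_charP. Qed.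

Lemma prepolar_polar_subset A : A `<=` prepolar (polar R A).
Proof. by move=> x Ax chi; apply; exists x. Qed.

Lemma nfold1_sumset0 K : sumset (nfold K 1) [set 0] = K.
Proof.
apply/seteqP; split=> [_ [a Ka [_ -> <-]]|a Ka]; first by rewrite addr0.
by exists a => //; exists 0 => //; rewrite addr0.
Qed.

(** The separating T-characters provided by quasi-convexity belong to the dual
group by compatibility. *)
Lemma prepolar_polar U : compatible R T ->
  @quasi_convex R (with_topology T) U -> prepolar (polar R U) = U.
Proof.
move=> compat qU; apply/seteqP; split; last exact: prepolar_polar_subset.
move=> x hx; apply: contrapT => /qU [chi [hchi nchi]]; apply: nchi.
have cchi : (chi : gstar R X) \in @continuous_char R X.
  by apply/asboolP; rewrite -compat; exact/asboolP/dual_charP.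
exact: (hx (Dual cchi) hchi).
Qed.

Section FromCompatible.
Hypothesis compat : compatible R T.

Lemma prepolar_nfold_polar_nbhs U n F : nbhs (0 : with_topology T) U ->
  finite_set F ->
  nbhs (0 : with_topology T) (prepolar (sumset (nfold (polar R U) n) F)).
Proof.
move=> U0 fF; apply: prepolar_equicontinuous; apply: equicontinuous_sumset.
  apply: equicontinuous_nfold => e e0.
  apply: filterS (near_star_polar U0 e0) => x h chi; exact: h.
apply: equicontinuous_finite => // chi _; rewrite compat.
exact: dual_continuous.
Qed.

Lemma polar_nbhs_Mac U : nbhs (0 : with_topology T) U -> Mac (polar R U).
Proof.
have starT V : nbhs (0 : with_topology T) V ->
    star_polar R V `<=` continuous_chars R X.
  by move=> V0; rewrite -compat; exact: (@star_polar_nbhs_continuous R (with_topology T)).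
move=> U0; split.
- exact: quasi_convex_polar.
- by apply: compact_polar; exact: starT.
- by move=> F n fF _ _; apply: starT; exact: prepolar_nfold_polar_nbhs.
Qed.

Lemma qc_nbhs_polars_directed : directed (qc_nbhs_polars R T).
Proof.
move=> _ _ [U [U0 qU] <-] [V [V0 qV] <-]; exists (polar R (U `&` V)).
  exists (U `&` V) => //; split; first exact: filterI.
  exact: (@quasi_convexI R (with_topology T)).
move=> chi [h|h] _ [x [Ux Vx] <-]; apply: h.
- by exists x.
- by exists x.
Qed.

Lemma qc_nbhs_polars_join : locally_quasi_convex R (with_topology T) ->
  is_join (TK_family (qc_nbhs_polars R T)) T.
Proof.
move=> [_ lqc]; split=> [t [K [qK [[U [U0 _] KE] ->]]]|T' hT'].
  apply/gopen_subP => V; rewrite nbhs_TK => -[_ [n [F [n1 fF F0 ->]]] WV].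
  by apply: filterS WV _; rewrite -KE; exact: prepolar_nfold_polar_nbhs.
apply/gopen_subP => U /lqc [V [V0 qV VU]].
have qP : quasi_convex R (polar R (V : set X)) by exact: quasi_convex_polar.
have VP : TK_base (polar R (V : set X)) V.
  exists 1%N, [set 0]; split=> //.
  by rewrite nfold1_sumset0 prepolar_polar.
have : gopen (TK qP) `<=` gopen T'.
  by apply: hT'; exists (polar R (V : set X)), qP; split=> //; exists V.
by move=> /gopen_subP; apply; rewrite nbhs_TK; exists V.
Qed.

End FromCompatible.

Section FromMac.
Variable KK : set (set (dual R X)).
Hypothesis gen : generated_by T KK.

(** A continuous character chi maps the prepolar of K + {0, chi}, which is a
neighborhood of 0 for the topology TK of K, into the half circle. *)
Lemma generated_continuous K (chi : dual R X) : KK K ->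
  continuous_chars R (with_topology T) chi.
Proof.
move=> KKK; have [KM _ [up _]] := gen; have [qK _ _] := KM _ KKK.
apply: (@star_polar_nbhs_continuous R (with_topology T)
  (prepolar (sumset (nfold K 1) [set 0; chi]))).
  have /gopen_subP : gopen (TK qK) `<=` gopen T by apply: up; exists K, qK.
  apply; rewrite nbhs_TK; eexists; last exact: subset_refl.
  exists 1%N, [set 0; chi]; split=> //; by left.
move=> _ [x hx <-]; apply: hx; exists 0; first exact: quasi_convex0.
by exists chi; [right|rewrite add0r].
Qed.

(** A T-continuous character maps the prepolar of some (n)K + F, with K in KK,
into the half circle; it is continuous by the definition of Mac. *)
Lemma continuous_generated K : KK K ->
  continuous_chars R (with_topology T) `<=` continuous_chars R X.
Proof.
move=> KKK chi cchi; have [KM dir join] := gen.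
have qK L : KK L -> quasi_convex R L by move=> /KM [].
have dirT s t : TK_family KK s -> TK_family KK t -> exists u,
    [/\ TK_family KK u, gopen s `<=` gopen u & gopen t `<=` gopen u].
  move=> [A [qA [KA ->]]] [B [qB [KB ->]]]; have [C KC ABC] := dir _ _ KA KB.
  exists (TK (qK _ KC)); split; first by exists C, (qK _ KC).
    by apply: TK_subset => x Ax; apply: ABC; left.
  by apply: TK_subset => x Bx; apply: ABC; right.
(* a deviation less than 1 means a positive real part *)
have chi0 : nbhs (0 : with_topology T) (chi @^-1` @Splus R).
  have := proj1 (@continuous_charE R (with_topology T) chi) cchi 1 ltr01.
  by apply: filterS => x h; split; [exact: gstar_norm|lra].
have famK : TK_family KK (TK (qK _ KKK)) by exists K, (qK _ KKK).
have [t [L [qL [KL ->]]]] := nbhs0_directed_join famK dirT join chi0.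
rewrite nbhs_TK => -[_ [n [F [n1 fF F0 ->]]] sub].
have [_ _ starL] := KM _ KL; apply: (starL F n fF F0 n1).
by move=> _ [x /sub hx <-].
Qed.

Lemma generated_compatible : hausdorff_space (with_topology T) ->
  compatible R T.
Proof.
(* if KK is empty, then T is indiscrete and the group is trivial *)
move=> hT; have [[K KKK]|noK] := pselect (exists K, KK K).
  apply/seteqP; split; first exact: continuous_generated KKK.
  move=> chi cchi; have cchi' : chi \in @continuous_char R X by exact/asboolP.
  exact: (@generated_continuous K (Dual cchi')).
have [_ _ [_ least]] := gen.
have trivX : forall x y : X, x = y.
  apply: hausdorff_indiscrete_trivial hT; apply: least => t [K [_ [KKK _]]].
  by case: noK; exists K.
have chi1 (chi : gstar R X) x : chi x = 1 by rewrite (trivX x 0) gstar_at0.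
apply/seteqP; split=> chi _; first exact: trivial_char_continuous (chi1 chi).
exact: (@trivial_char_continuous R (with_topology T) _ (chi1 chi)).
Qed.

End FromMac.

End Compatible.

Theorem theorem3p8 (R : realType) (G : topologicalZmodType)
    (T : group_topology G) (MAP_G : MAP R G)
    (lqc_T : locally_quasi_convex R (with_topology T)) :
  (compatible R T <-> exists KK : set (set (dual R G)), generated_by T KK) /\
  (compatible R T -> generated_by T (qc_nbhs_polars R T)).
Proof.
have gen : compatible R T -> generated_by T (qc_nbhs_polars R T).
  move=> compat; split; [|exact: qc_nbhs_polars_directed|exact: qc_nbhs_polars_join].
  by move=> _ [U [U0 _] <-]; exact: (polar_nbhs_Mac compat U0).
split; last exact: gen.
split=> [/gen genT|[KK genKK]]; first by exists (qc_nbhs_polars R T).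
exact: (generated_compatible genKK (proj1 lqc_T)).
Qed.
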